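(* Let $n$ be a positive integer with $\phi(n)=\frac{2}{3}\cdot (n+1)$, where $\phi$ is Euler's totient function. Then $n$ is square-free. *)

(* Defs.v *)
From mathcomp Require Import all_boot all_order all_algebra.

Definition squarefree (n : nat) : Prop := forall d : nat, d ^ 2 %| n -> d = 1.

(* Main.v *)
(** If p^2 divides n then p divides both n and phi(n), so 3 phi(n) = 2(n + 1)
    forces p | 2; but then n is even, and phi(n) <= n / 2 is too small. *)
Require Import Defs.
From mathcomp Require Import all_boot all_order all_algebra.
From mathcomp Require Import zify ring.

Lemma totient_leq (n : nat) : totient n <= n.
Proof.
rewrite totient_count_coprime -[leqRHS]muln1 -[n in n * 1]subn0 -sum_nat_const_nat.
by rewrite leq_sum // => i _; case: coprime.
Qed.

(** With [n = m * p ^ e], [m] prime to [p] and [e >= 2], the factor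
    [totient (p ^ e) = p.-1 * p ^ e.-1] still contains a [p]. *)
Lemma dvdn_totient_sqr (p n : nat) :
  prime p -> 0 < n -> p ^ 2 %| n -> p %| totient n.
Proof.
move=> p_pr n_gt0; rewrite (pfactor_dvdn 2 p_pr n_gt0) => le_2.
have [m cop_pm ->] := pfactor_coprime p_pr n_gt0.
case: (logn p n) le_2 => [|[|e]] // _.
rewrite totient_coprime 1?coprime_sym ?coprimeXl // totient_pfactor //=.
by rewrite expnS dvdn_mull // dvdn_mull // dvdn_mulr.
Qed.

(** With [n = m * 2 ^ e.+1] and [m] odd, [totient n = totient m * 2 ^ e], and [totient m <= m]. *)
Lemma totient_even_leq (n : nat) : 0 < n -> 2 %| n -> 2 * totient n <= n.
Proof.
move=> n_gt0; rewrite -[X in X %| _](expn1 2) (pfactor_dvdn 1 _ n_gt0) // => le_1.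
have [m cop_2m ->] := @pfactor_coprime 2 n isT n_gt0.
case: (logn 2 n) le_1 => [|e] // _.
rewrite totient_coprime 1?coprime_sym ?coprimeXl // totient_pfactor //= mul1n.
by rewrite mulnCA -expnS leq_mul2r totient_leq orbT.
Qed.

Theorem theorem1 (n : nat) (n_gt0 : (0 < n)%N)
  (phi_n : ((totient n)%:R = 2 / 3 * (n%:R + 1) :> rat)%R) :
  squarefree n.
Proof.
have phiE : 3 * totient n = 2 * n.+1.
  apply/eqP; rewrite -(Num.Theory.eqr_nat rat) !GRing.natrM phi_n -GRing.natr1.
  by apply/eqP; field.
move=> d d2n; apply/eqP/negPn/negP => d_neq1.
(* The case [d = 0] is ruled out because it would force [n = 0]. *)
have d_gt1 : 1 < d by case: d d_neq1 d2n => [|[|d]] // _; rewrite dvd0n; lia.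
have p_pr := pdiv_prime d_gt1; set p := pdiv d in p_pr.
have p2n : p ^ 2 %| n by rewrite (dvdn_trans _ d2n) // dvdn_exp2r // pdiv_dvd.
have pn : p %| n by rewrite (dvdn_trans _ p2n) // dvdn_mulr.
have : p %| 3 * totient n by rewrite dvdn_mull // dvdn_totient_sqr.
(* Since [2 * n.+1 = 2 + 2 * n] and [p] divides [n], [p] divides 2. *)
rewrite phiE mulnS dvdn_addl; last by rewrite dvdn_mull.
rewrite dvdn_prime2 // => /eqP p2.
(* Now [4 * n.+1 = 6 * totient n <= 3 * n], which is absurd. *)
have := totient_even_leq _ n_gt0; rewrite -p2 => /(_ pn); lia.
Qed.
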